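(* Let $H$ be a bipartite graph with bipartition $(P,N)$, and let $\mathcal{T}(H)$ be the set of all spanning trees of $H$. Then $$|\{\deg_T(P) : T\in\mathcal{T}(H)\}|=|\{\deg_T(N) : T\in\mathcal{T}(H)\}|.$$
   Context: Graphs are finite, undirected and simple. $H$ has node set $P\cup N$ with $P,N$ nonempty and disjoint, and every edge of $H$ joins a node of $P$ and a node of $N$. A spanning tree of $H$ is a connected subgraph with the same node set as $H$ and without cycles. For a spanning tree $T$ and a set $A$ of nodes, $\deg_T(A)$ is the vector indexed by $A$ whose component at $i\in A$ is $\deg_T(i)$, the number of edges of $T$ incident to $i$. *)

(* Defs.v *)
From mathcomp Require Import all_boot finmap.

Set Implicit Arguments.
Unset Strict Implicit.
Unset Printing Implicit Defensive.

(* A simple graph on V is given by a symmetric irreflexive adjacency relation;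
   its spanning subgraphs are identified with their edge sets, an edge being
   the set of its two ends. *)
Section Graphs.
Variable V : finType.
Implicit Types (e : rel V) (T : {set {set V}}) (A P N : {set V}).

Definition simple_graph e := symmetric e /\ irreflexive e.

Definition bipartition e P N :=
  [/\ P != set0, N != set0, [disjoint P & N], P :|: N = [set: V]
    & forall x y : V, e x y ->
        (x \in P /\ y \in N) \/ (x \in N /\ y \in P)].

Definition edges e : {set {set V}} := [set [set x; y] | x : V, y : V in e x].

Definition adj T : rel V := fun x y => [set x; y] \in T.

Definition connected T := [forall x, forall y, connect (adj T) x y].

(* A cycle has at least 3 nodes, since x, y is always a closed adj-walk when
   xy is an edge. Its nodes being distinct, it has at most #|V| of them, and
   this bound makes the quantification finite. *)
Definition acyclic T :=
  ~~ [exists k : 'I_#|V|.+1, exists c : k.-tuple V,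
        (2 < k) && ucycleb (adj T) c].

Lemma acyclicP T :
  reflect (forall c : seq V, ucycle (adj T) c -> size c <= 2) (acyclic T).
Proof.
apply: (iffP idP) => [acT c cyc | acT].
  rewrite leqNgt; apply: contra acT => c_gt2.
  have [_ uc] := andP cyc.
  have lec : size c < #|V|.+1 by rewrite ltnS -(card_uniqP uc) max_card.
  apply/existsP; exists (Ordinal lec); apply/existsP; exists (in_tuple c).
  by rewrite c_gt2.
apply/existsP => -[k /existsP[c /andP[k_gt2 /acT]]].
by rewrite size_tuple leqNgt k_gt2.
Qed.

Definition spanning_trees e : {set {set {set V}}} :=
  [set T : {set {set V}} | [&& T \subset edges e, connected T & acyclic T]].

Definition deg T (i : V) : nat := #|[set f in T | i \in f]|.

Definition deg_vector T A : {ffun {i : V | i \in A} -> nat} :=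
  [ffun i => deg T (val i)].

End Graphs.

(* Main.v *)
Require Import Defs.
From mathcomp Require Import all_boot all_order all_algebra finmap.
From mathcomp Require Import zify ring boolp.

Set Implicit Arguments.
Unset Strict Implicit.
Unset Printing Implicit Defensive.
Import Order.TTheory GRing.Theory Num.Theory.
Local Open Scope ring_scope.

(** The proof singles out a set of spanning trees, defined without reference
to the sides P and N, on which both T |-> deg_T(P) and T |-> deg_T(N) are
injective and attain every degree vector of a spanning tree. Both cardinalities
are then the number of these trees. (Geometrically, they are the simplices of a
regular triangulation of the root polytope of the graph.)

Give the edges the weights 1, 2, 4, ... A potential z : V -> int is feasible if
z x + z y is at most the weight of xy for every edge xy, and its tight edges are
those where equality holds. The distinguished trees, called regular, are those
that are the set of all tight edges of a feasible potential. This is linear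
programming duality for a transportation problem. Let k = #|P| and let f be the
degree vector on P of a spanning tree; each node p of P supplies
k (f p - 1) + 1 units, each node of N demands k units, and the dual objective is

  L_f(z) = \sum_(p in P) (k (f p - 1) + 1) z p + k \sum_(n in N) z n.

For a tree T with degrees f on P, orienting T towards a root q in P gives each
n in N a parent in P, and p is the parent of f p - [p != q] nodes. Summing over
the k possible roots, L_f(z) is the sum over q and n of the load z (parent n) +
z n (objective_parent), so for feasible z it is at most the corresponding sum of
weights, and equality forces all edges of T to be tight (tight_tree).

Injectivity (regular_inj): if T1 and T2 are the tight edges of z1 and z2 and
agree in degree on P, the bound for T1 gives L_f(z2) <= L_f(z1), the one for T2
the converse. Hence T1 is tight for z2, so contained in T2, and symmetrically.

Surjectivity (regular_exists): as L_f is bounded on feasible potentials, some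
feasible z cannot be improved by adding 1 on P and subtracting 1 on N inside a
set X of nodes that the tight edges do not leave from P to N. Its tight edges
form no cycle because the weights are distinct powers of 2 (tight_acyclic).
They form a connected graph: for a component X, both X and its complement are
such sets and their gains add up to 0, so the gain of X is 0; modulo k this
says that k divides #|P :&: X|, so X contains P, and a gain of 0 then leaves
no node of N outside X. So the tight edges form a spanning tree. Taking X to
be p and its tight neighbours, the gain is k (f p - 1) + 1 minus k times the
tight degree of p, so that degree is at least f p; the degrees on P have the
same sum in all spanning trees, so equality holds. *)

(** * Orienting a tree towards a root *)

Section Parents.
Variables (V : finType) (T : {set {set V}}).
Implicit Types x y q : V.

Lemma adj_sym : symmetric (adj T).
Proof. by move=> x y; rewrite /adj setUC. Qed.

Definition avoid x : rel V := fun a b => [&& adj T a b, a != x & b != x].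

(** In a tree with root q, this says that y is the parent of x. *)
Definition towards q : rel V :=
  fun x y => adj T x y && connect (avoid x) y q.

Definition parent q x : V := odflt x [pick y | towards q x y].

Lemma avoid_connect_sym x : connect_sym (avoid x).
Proof.
apply: sym_connect_sym => a b; rewrite /avoid adj_sym.
by rewrite (andbC (a != x)).
Qed.

Lemma path_avoid x y s :
  x \notin y :: s -> path (avoid x) y s = path (adj T) y s.
Proof.
elim: s y => //= z s IHs y; rewrite !inE !negb_or => /and3P[yx zx xs].
rewrite IHs ?inE ?negb_or ?zx // /avoid.
by rewrite ![_ == x]eq_sym yx zx !andbT.
Qed.

Lemma avoid_notin x y s : y != x -> path (avoid x) y s -> x \notin y :: s.
Proof.
elim: s y => [|z s IHs] y yx /=; first by rewrite inE eq_sym.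
case/andP=> /and3P[_ _ zx] /(IHs z zx) xzs.
by rewrite in_cons negb_or [x == y]eq_sym yx.
Qed.

Lemma towards_exists q x :
  connect (adj T) x q -> x != q -> exists y, towards q x y.
Proof.
case/connectP=> s /shortenP[[|y s'] /= pT us _ ->]; first by rewrite eqxx.
case/andP: pT => xy pT _; case/andP: us => xs _.
exists y; rewrite /towards xy; apply/connectP; exists s' => //.
by rewrite path_avoid.
Qed.

Hypothesis adjI : irreflexive (adj T).

Lemma adj_neq x y : adj T x y -> y != x.
Proof. by apply: contraTneq => ->; rewrite adjI. Qed.

Lemma towards_root q y : ~~ towards q q y.
Proof.
apply/negP=> /andP[/adj_neq yq /connectP[s ps lasts]].
by have := avoid_notin yq ps; rewrite {1}lasts mem_last.
Qed.

Hypothesis acT : acyclic T.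

(** Two such neighbours of x would be joined by a path avoiding x, which x
closes into a cycle. *)
Lemma towards_uniq q x y y' : towards q x y -> towards q x y' -> y = y'.
Proof.
move=> /andP[xy yq] /andP[xy' y'q]; apply/eqP; apply: contraT => yy'.
have yx := adj_neq xy.
have: connect (avoid x) y y'.
  by apply: connect_trans yq _; rewrite avoid_connect_sym.
case/connectP=> s0 /shortenP[s ps us _ lasts].
have xs := avoid_notin yx ps.
have: ucycle (adj T) [:: x, y & s].
  rewrite /ucycle /= xy rcons_path -(path_avoid xs) ps -lasts adj_sym xy' /=.
  by rewrite /= in us; rewrite us xs.
move/(acyclicP _ acT); case: s lasts {ps us xs} => //= eqy.
by rewrite eqy eqxx in yy'.
Qed.

(** Every edge of a tree has exactly one orientation towards the root. *)
Lemma towardsC q x y :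
  connected T -> adj T x y -> towards q x y = ~~ towards q y x.
Proof.
move=> coT xy; have yx := adj_neq xy.
have coxq a : connect (adj T) a q by move/forallP/(_ a)/forallP/(_ q): coT.
have [eqx | xq] := eqVneq x q.
  rewrite -eqx (negPf (towards_root x y)) /towards adj_sym xy.
  by rewrite connect0.
apply/idP/idP => [txy | ntyx].
  apply/negP => /andP[_ /connectP[s0 /shortenP[[|a s] ps us _ lasts]]].
    by rewrite /= in lasts; rewrite lasts eqxx in xq.
  have ys := avoid_notin (adj_neq (eq_trans (adj_sym y x) xy)) ps.
  have {}ps : path (adj T) x (a :: s) by rewrite -(path_avoid ys).
  move: us ps => /= /andP[xas us] /andP[xa ps].
  have txa : towards q x a.
    by rewrite /towards xa; apply/connectP; exists s; rewrite ?path_avoid.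
  by rewrite (towards_uniq txy txa) !inE eqxx orbT in ys.
(* If y is not the next node a after x, the path from a to q either meets y,
   and then leads from y to q without x, or misses it, and then leads from x
   to q without y. *)
have [a txa] := towards_exists (coxq x) xq.
have [<- // | ay] := eqVneq a y.
case/andP: (txa) => xa /connectP[s ps lasts].
have xs := avoid_notin (adj_neq xa) ps.
have [ys | ys] := boolP (y \in a :: s).
  move: ps lasts; case/splitPl: ys => s1 s2 lasts1.
  rewrite cat_path last_cat lasts1.
  case/andP=> _ ps2 lasts2; rewrite /towards xy; apply/connectP; by exists s2.
case/negP: ntyx; rewrite /towards adj_sym xy.
apply/connectP; exists (a :: s) => //.
have yxs : y \notin [:: x, a & s] by rewrite in_cons negb_or yx.
by rewrite (path_avoid yxs) /= xa -(path_avoid xs).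
Qed.

Lemma towards_parentE q x y :
  towards q x y = (towards q x (parent q x) && (parent q x == y)).
Proof.
apply/idP/andP => [txy | [txp /eqP<-] //].
rewrite /parent; case: pickP => [y' txy' | /(_ y)]; last by rewrite txy.
by rewrite (towards_uniq txy txy').
Qed.

Lemma towards_parent q x : connected T -> x != q -> towards q x (parent q x).
Proof.
move=> /forallP/(_ x)/forallP/(_ q) xq x_q.
by have [y] := towards_exists xq x_q; rewrite towards_parentE => /andP[].
Qed.

(** The neighbours of x are its children and, unless x is the root, its
parent. *)
Lemma card_adj_parent q x : connected T ->
  #|[set y | adj T x y]| =
  #|[set y | (y != q) && (parent q y == x)]| + (x != q).
Proof.
move=> coT; set A := [set y | adj T x y].
rewrite -(cardsID [set y | towards q x y] A) addnC; congr (_ + _).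
  apply: eq_card => y; rewrite !inE.
  have [-> | yq] := eqVneq y q.
    rewrite andFb; apply/negP => /andP[ntxq xq].
    by rewrite (towardsC _ coT xq) (negPf (towards_root q x)) in ntxq.
  rewrite -[RHS]andTb -(towards_parent coT yq) -towards_parentE.
  apply/andP/idP => [[nt xy] | tyx].
    by rewrite (towardsC _ coT) // adj_sym.
  have xy : adj T x y by rewrite adj_sym; case/andP: tyx.
  by rewrite -(towardsC _ coT) // adj_sym xy.
have -> : A :&: [set y | towards q x y] = [set y | towards q x y].
  by apply/setIidPr/subsetP => y; rewrite !inE => /andP[].
have [-> | xq] := eqVneq x q.
  by apply: eq_card0 => y; rewrite inE (negPf (towards_root q y)).
apply/eqP/cards1P; exists (parent q x); apply/setP => y.
by rewrite !inE -/(towards q x y) towards_parentE towards_parent //= eq_sym.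
Qed.

End Parents.

(** * Edges and degrees in a bipartite graph *)

Section Bipartite.
Variables (V : finType) (e : rel V) (P N : {set V}).
Hypotheses (e_simple : simple_graph e) (PN_bip : bipartition e P N).
Implicit Types (T : {set {set V}}) (x y p n q : V) (z : V -> int) (X : {set V}).

Lemma mem_edges x y : ([set x; y] \in edges e) = e x y.
Proof.
have [e_sym _] := e_simple.
apply/imset2P/idP => [[a b _ eab eq_xy] | exy]; last by exists x y.
have : (a \in [set x; y]) && (b \in [set x; y]) by rewrite eq_xy set21 set22.
have : (x \in [set a; b]) && (y \in [set a; b]) by rewrite -eq_xy set21 set22.
have eba : e b a by rewrite e_sym.
rewrite !in_set2.
case/andP=> /orP[]/eqP-> /orP[]/eqP-> //;
  rewrite !orbb => /andP[/eqP ab /eqP ba].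
  by rewrite -{2}ba.
by rewrite -{1}ab.
Qed.

Lemma edgesP f :
  reflect (exists2 xy, e xy.1 xy.2 & f = [set xy.1; xy.2]) (f \in edges e).
Proof.
apply: (iffP imset2P) => [[x y _ exy ->] | [[x y] exy ->]].
  by exists (x, y).
by exists x y.
Qed.

Lemma in_N x : (x \in N) = (x \notin P).
Proof.
have [_ _ dPN PuN _] := PN_bip.
have : x \in P :|: N by rewrite PuN inE.
rewrite inE; have [xP _ | _ /= -> //] := boolP (x \in P).
by rewrite (disjointFr dPN xP).
Qed.

Lemma edge_flip x y : e x y -> (y \in P) = (x \notin P).
Proof.
have [_ _ _ _ bip] := PN_bip.
case/bip=> -[xPN yPN]; last by rewrite yPN -in_N xPN.
by rewrite xPN; apply/negbTE; rewrite -in_N.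
Qed.

Lemma edge_PN f : f \in edges e ->
  exists p n, [/\ p \in P, n \in N, e p n & f = [set p; n]].
Proof.
have [e_sym _] := e_simple.
case/edgesP=> -[x y] /= exy ->; have yx := edge_flip exy.
have [xP | xP] := boolP (x \in P); first by exists x, y; rewrite in_N yx xP.
by exists y, x; rewrite in_N yx xP e_sym setUC.
Qed.

Section Subgraph.
Variable T : {set {set V}}.
Hypothesis Te : T \subset edges e.

Lemma adj_edge x y : adj T x y -> e x y.
Proof. by rewrite -mem_edges; apply: subsetP. Qed.

Lemma adj_irr : irreflexive (adj T).
Proof.
have [_ e_irr] := e_simple.
by move=> x; apply/negP => /adj_edge; rewrite e_irr.
Qed.

Lemma degE x : deg T x = #|[set y | adj T x y]|.
Proof.
rewrite /deg -(card_in_imset (f := fun y => [set x; y])).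
  apply: eq_card => f; rewrite inE; apply/andP/imsetP => [[fT xf] | [y xy ->]].
    have /edgesP[[a b] /= eab eqf] := subsetP Te f fT.
    rewrite eqf in_set2 in xf.
    by case/orP: xf eqf => /eqP <-;
      [exists b | rewrite setUC; exists a] => //; rewrite inE /adj -eqf.
  by rewrite inE in xy; rewrite set21.
move=> y y'; rewrite !inE => xy xy' eqs.
have : y \in [set x; y'] by rewrite -eqs set22.
by rewrite in_set2 => /orP[/eqP yx|/eqP//]; rewrite yx adj_irr in xy.
Qed.

End Subgraph.

(** * Potentials and tight edges *)

(** Distinct powers of 2: among the edges of a cycle, all but one have a weight
divisible by twice the smallest one. *)
Definition weight (f : {set V}) : int := 2 ^+ enum_rank f.

Definition load z (f : {set V}) : int := \sum_(x in f) z x.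

Definition feasible z := forall f, f \in edges e -> load z f <= weight f.

Definition tight z := [set f in edges e | load z f == weight f].

Definition regular T := exists2 z, feasible z & T = tight z.

Lemma loadE z x y : e x y -> load z [set x; y] = z x + z y.
Proof.
move=> exy; rewrite /load big_setU1 ?big_set1 // inE.
by apply: contraTneq exy => ->; have [_ ->] := e_simple.
Qed.

(** The dual objective of the transportation problem with supplies
#|P| (f p - 1) + 1 and demands #|P|. The added 1, small against #|P|, makes
the optimum nondegenerate, so that the tight edges of an optimal potential
connect the graph. *)
Definition objective (f : V -> nat) z : int :=
  \sum_(p in P) (#|P|%:Z * ((f p)%:Z - 1) + 1) * z p +
  #|P|%:Z * \sum_(n in N) z n.

Lemma spanning_treeP T :
  reflect [/\ T \subset edges e, connected T & acyclic T]
    (T \in spanning_trees e).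
Proof. by rewrite inE; apply: and3P. Qed.

Section Tree.
Variable T : {set {set V}}.
Hypothesis treeT : T \in spanning_trees e.

Lemma adj_parent q n : n != q -> adj T n (parent T q n).
Proof.
have /spanning_treeP[Te coT acT] := treeT.
by move=> nq; have /andP[] := towards_parent (adj_irr Te) acT coT nq.
Qed.

Lemma PN_neq q n : q \in P -> n \in N -> n != q.
Proof. by move=> qP; apply: contraTneq => ->; rewrite in_N qP. Qed.

Lemma parent_edge q n : q \in P -> n \in N -> e (parent T q n) n.
Proof.
have /spanning_treeP[Te coT acT] := treeT; have [e_sym _] := e_simple.
by move=> qP nN; rewrite e_sym (adj_edge Te) // adj_parent // PN_neq.
Qed.

Lemma parent_in q n : q \in P -> n \in N -> parent T q n \in P.
Proof.
move=> qP nN; have := edge_flip (parent_edge qP nN).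
by rewrite in_N in nN; rewrite (negbTE nN) => /esym/negbFE.
Qed.

Lemma deg_parent q p : q \in P -> p \in P ->
  deg T p = (#|[set n in N | parent T q n == p]| + (p != q))%N.
Proof.
have /spanning_treeP[Te coT acT] := treeT.
move=> qP pP; rewrite degE // (card_adj_parent (adj_irr Te) acT q) //.
congr (_ + _)%N; apply: eq_card => n; rewrite !inE.
have [nN | nP] := boolP (n \in N); first by rewrite (PN_neq qP nN).
have [//|nq /=] := eqVneq n q; apply/eqP => eqp.
have := edge_flip (adj_edge Te (adj_parent nq)).
by rewrite eqp pP -in_N (negbTE nP).
Qed.

(** The supply of p is the number of pairs of a root q and a child n of p in T
rooted at q: there are f p children if q = p, and f p - 1 for each of the
other roots. *)
Lemma objective_parent z :
  objective (deg T) z =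
  \sum_(q in P) \sum_(n in N) load z [set parent T q n; n].
Proof.
have sumq q : q \in P -> \sum_(n in N) load z [set parent T q n; n] =
    \sum_(p in P) ((deg T p)%:Z - 1 + (p == q)%:Z) * z p + \sum_(n in N) z n.
  move=> qP.
  under eq_bigr => n nN do rewrite (loadE _ (parent_edge qP nN)).
  rewrite big_split /=; congr (_ + _).
  rewrite (partition_big (parent T q) (mem P)); last first.
    by move=> n nN; apply: parent_in.
  apply: eq_bigr => p pP.
  under eq_bigr => n /andP[_ /eqP->] do [].
  rewrite (deg_parent qP pP).
  rewrite (eq_bigl [in [set n in N | parent T q n == p]]); last first.
    by move=> n; rewrite inE.
  rewrite sumr_const -mulr_natl; congr (_ * _).
  by case: (p == q); rewrite /= ?natz; lia.
rewrite (eq_bigr _ sumq) big_split /= sumr_const exchange_big /= /objective.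
congr (_ + _); last by rewrite -mulr_natl natz.
apply: eq_bigr => p pP; rewrite -mulr_suml big_split /= sumr_const.
congr (_ * _).
rewrite -mulr_natl natz (bigD1 p) //= eqxx big1 ?addr0 //.
by move=> q /andP[_ qp]; rewrite eq_sym (negPf qp).
Qed.

(** * Regular trees are determined by their degrees on P *)

Lemma objective_le z : feasible z ->
  objective (deg T) z <=
  \sum_(q in P) \sum_(n in N) weight [set parent T q n; n].
Proof.
move=> fz; rewrite objective_parent.
apply: ler_sum => q qP; apply: ler_sum => n nN.
by apply: fz; rewrite mem_edges parent_edge.
Qed.

Lemma objective_tight z : T \subset tight z ->
  objective (deg T) z =
  \sum_(q in P) \sum_(n in N) weight [set parent T q n; n].
Proof.
move=> sub; rewrite objective_parent.
apply: eq_bigr => q qP; apply: eq_bigr => n nN.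
have: [set parent T q n; n] \in T.
  by rewrite setUC; apply: adj_parent (PN_neq qP nN).
by move/(subsetP sub); rewrite inE => /andP[_ /eqP].
Qed.

(** Complementary slackness. Every edge of T does occur in the sum: an edge pn
joins n to its parent when p itself is the root. *)
Lemma tight_tree z :
  feasible z ->
  objective (deg T) z =
  \sum_(q in P) \sum_(n in N) weight [set parent T q n; n] ->
  T \subset tight z.
Proof.
have /spanning_treeP[Te coT acT] := treeT.
move=> fz; rewrite objective_parent => eqLW.
have slack_ge0 q n : q \in P -> n \in N ->
    0 <= weight [set parent T q n; n] - load z [set parent T q n; n].
  by move=> qP nN; rewrite subr_ge0; apply: fz; rewrite mem_edges parent_edge.
apply/subsetP => f fT; have fe := subsetP Te f fT; rewrite inE fe /=.
have [p [n [pP nN _ eqf]]] := edge_PN fe.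
have <- : [set parent T p n; n] = f.
  have: towards T p n p by rewrite /towards connect0 adj_sym /adj -eqf fT.
  by rewrite (towards_parentE (adj_irr Te) acT) eqf => /andP[_ /eqP->].
rewrite eq_sym -subr_eq0; apply/eqP.
have sum0 : \sum_(q in P) \sum_(n in N)
    (weight [set parent T q n; n] - load z [set parent T q n; n]) = 0.
  by under eq_bigr => q _ do rewrite sumrB; rewrite sumrB eqLW subrr.
have row0 :=
  psumr_eq0P (fun q qP => sumr_ge0 _ (fun n => slack_ge0 q n qP)) sum0.
exact: psumr_eq0P (fun n => slack_ge0 p n pP) (row0 p pP) n nN.
Qed.

End Tree.

Lemma eq_objective f f' z : {in P, f =1 f'} -> objective f z = objective f' z.
Proof.
by move=> eqf; congr (_ + _); apply: eq_bigr => p pP; rewrite eqf.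
Qed.

Lemma tree_sub_tight T1 T2 z1 z2 :
    T1 \in spanning_trees e -> T2 \in spanning_trees e ->
    feasible z1 -> feasible z2 -> T1 \subset tight z1 -> T2 \subset tight z2 ->
    {in P, deg T1 =1 deg T2} -> T1 \subset tight z2.
Proof.
move=> tree1 tree2 fz1 fz2 sub1 sub2 eqdeg; apply: tight_tree => //.
apply: le_anti; rewrite objective_le //= -(objective_tight tree1 sub1).
rewrite !(eq_objective _ eqdeg) (objective_tight tree2 sub2).
exact: objective_le.
Qed.

Lemma regular_inj T1 T2 :
    T1 \in spanning_trees e -> T2 \in spanning_trees e ->
    regular T1 -> regular T2 -> {in P, deg T1 =1 deg T2} -> T1 = T2.
Proof.
move=> tree1 tree2 [z1 fz1 eq1] [z2 fz2 eq2] eqdeg.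
have sub1 : T1 \subset tight z1 by rewrite -eq1.
have sub2 : T2 \subset tight z2 by rewrite -eq2.
apply/eqP; rewrite eqEsubset {1}eq2 {2}eq1.
rewrite (tree_sub_tight tree1 tree2 fz1 fz2) //.
rewrite (tree_sub_tight tree2 tree1 fz2 fz1) //.
by move=> p pP; rewrite eqdeg.
Qed.

(** * Tight edges form no cycle *)

Definition side x : int := if x \in P then 1 else - 1.

Lemma side_edge x y : e x y -> side y = - side x.
Proof. by move=> exy; rewrite /side (edge_flip exy); case: (x \in P). Qed.

Lemma side_tight z x y : [set x; y] \in tight z ->
  side y * z y - side x * z x = - side x * weight [set x; y].
Proof.
rewrite inE mem_edges => /andP[exy /eqP <-].
by rewrite loadE // (side_edge exy); ring.
Qed.

(** Let xy be the edge of least weight 2 ^ r on a cycle. Modulo 2 ^ (r + 1) the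
other edges of the cycle have weight 0, so, if they are tight, side * z is
constant along the path that they form from y to x. But then the load of xy is
0 modulo 2 ^ (r + 1), and so xy is not tight. *)
Lemma tight_acyclic z : acyclic (tight z).
Proof.
apply/acyclicP => c /andP[cyc uc]; rewrite leqNgt; apply/negP => c_gt2.
have [x0 x0c] : exists x, x \in c.
  by case: c c_gt2 {cyc uc} => // x c _; exists x; rewrite mem_head.
pose r x : nat := enum_rank [set x; next c x].
have [x xc xmin] := arg_minnP (P := [in c]) r x0c.
have [i c' eqc] := rot_to xc.
have : cycle (frel (next c)) (rot i c) by rewrite rot_cycle cycle_next.
have {cyc}: cycle (adj (tight z)) (rot i c) by rewrite rot_cycle.
have memc : c =i rot i c by move=> a; rewrite mem_rot.
move: uc c_gt2; rewrite -(size_rot i) -(rot_uniq i).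
rewrite eqc in memc *; case: c' {eqc} memc => [|y [|y' s]] // memc.
set s1 := y' :: s => uc _ cyc nxt.
have: path [rel a b | adj (tight z) a b && (next c a == b)]
        x (rcons (y :: s1) x).
  by rewrite path_relI; apply/andP.
rewrite rcons_path => /andP[/= /andP[/andP[xy /eqP nx]]] ps.
case/andP=> lastx /eqP nlast.
set m : int := 2 ^+ (r x).+1.
(* Only the first end of the step is required to differ from x, as the last
   step of the path arrives at x. *)
have step a b : a \in y :: s1 -> [set a; b] \in tight z -> next c a = b ->
    (m %| side b * z b - side a * z a)%Z.
  move=> a_s ab nab; rewrite (side_tight ab) dvdz_mull // /m /weight.
  rewrite dvdz_exp2l // ltn_neqAle.
  have -> : (enum_rank [set a; b] : nat) = r a by rewrite /r nab.
  have -> : (r x <= r a)%N by apply: xmin; rewrite memc in_cons a_s orbT.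
  rewrite andbT.
  apply/eqP => /val_inj/enum_rank_inj; rewrite nab nx => eqab.
  have xa : x != a by apply: contraTneq a_s => <-; case/andP: uc.
  (* As a is not x, the step from a to b would be xy run backwards, and the
     cycle would have length 2. *)
  have /eqP eqb : x == b.
    have : x \in [set a; b] by rewrite -eqab set21.
    by rewrite !in_set2 (negPf xa).
  have /eqP eqa : a == y.
    have : a \in [set x; y] by rewrite eqab set21.
    by rewrite in_set2 eq_sym (negPf xa).
  have ny : next c y = y' by move: ps; rewrite /s1 /= => /andP[/andP[_ /eqP]].
  by move: uc; rewrite /s1 -ny -eqa nab -eqb /= !inE eqxx !orbT.
have chain s2 a : all [in y :: s1] (a :: s2) ->
    path [rel a b | adj (tight z) a b && (next c a == b)] a s2 ->
    (m %| side (last a s2) * z (last a s2) - side a * z a)%Z.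
  elim: s2 a => [|b s2 IHs] a /=; first by rewrite subrr dvdz0.
  case/and3P=> a_s b_s s2_s /andP[/andP[ab /eqP nab] ps2].
  rewrite -(subrKA (side b * z b)); apply: rpredD; last exact: step.
  by apply: IHs => //; apply/andP.
have : (m %| side x * z x - side y * z y)%Z.
  set l := last y s1 in lastx nlast.
  rewrite -(subrKA (side l * z l)); apply: rpredD.
    by apply: step => //; rewrite mem_last.
  by apply: chain => //; apply/allP.
have yx : [set y; x] \in tight z by rewrite setUC.
rewrite (side_tight yx) setUC /weight -nx -/(r x) nx.
case/dvdzP=> q; rewrite /m exprS /side.
have: (2 : int) ^+ r x != 0 by rewrite expf_neq0.
move=> /mulIf inj; case: ifP => _.
  rewrite mulrA => /inj; lia.
rewrite mulrA => /inj; lia.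
Qed.

(** * A locally optimal potential *)

Definition shift X x : int := if x \in X then side x else 0.

Definition closed_under z X :=
  [forall p in P :&: X, forall n in N :\: X, [set p; n] \notin tight z].

Lemma closed_underP z X :
  reflect (forall p n, p \in P -> n \in N -> [set p; n] \in tight z ->
             p \in X -> n \in X)
          (closed_under z X).
Proof.
apply: (iffP forall_inP) => [clX p n pP nN pn pX | clX p /setIP[pP pX]].
  apply: contraTT pn => nX.
  have /clX/forall_inP : p \in P :&: X by rewrite inE pP.
  by apply; rewrite inE nX.
apply/forall_inP => n /setDP[nN nX]; apply: contra nX => pn.
exact: clX pn pX.
Qed.

(** Only edges from P :&: X to N :\: X gain load, and only by 1; these are not
tight, and loads are integers. *)
Lemma feasible_shift z X :
  feasible z -> closed_under z X -> feasible (fun x => z x + shift X x).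
Proof.
move=> fz /closed_underP clX f fe.
have [p [n [pP nN epn eqf]]] := edge_PN fe.
have := fz f fe; have := clX p n pP nN.
rewrite eqf !(loadE _ epn) inE -eqf fe /= eqf (loadE _ epn).
have nP : n \in P = false by apply/negbTE; rewrite -in_N.
rewrite /shift /side pP nP => clpn le_w.
have [eqw | ltw] := eqVneq (z p + z n) (weight [set p; n]).
  by move: (clpn (introT eqP eqw)); case: ifP => _; case: ifP => _; lia.
by case: ifP => _; case: ifP => _; lia.
Qed.

Lemma objectiveD f z z' :
  objective f (fun x => z x + z' x) = objective f z + objective f z'.
Proof.
rewrite /objective; under eq_bigr => p _ do rewrite mulrDr.
by rewrite !big_split /= mulrDr addrACA.
Qed.

Lemma objective_shift f X :
  objective f (shift X) =
  \sum_(p in P :&: X) (#|P|%:Z * ((f p)%:Z - 1) + 1) - #|P|%:Z * #|N :&: X|%:Z.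
Proof.
rewrite /objective -mulrN; congr (_ + _ * _).
  rewrite big_mkcond [RHS]big_mkcond; apply: eq_bigr => p _.
  rewrite inE /shift /side.
  by case: (p \in P); case: (p \in X); rewrite ?mulr1 ?mulr0.
rewrite -natz -sumr_const -sumrN big_mkcond [RHS]big_mkcond.
apply: eq_bigr => n _.
by rewrite inE /shift /side in_N; case: (n \in P); case: (n \in X).
Qed.

(** Each improving shift raises the integer objective, which is bounded on
feasible potentials. *)
Lemma local_optimum T : T \in spanning_trees e ->
  exists2 z, feasible z &
    forall X, closed_under z X -> objective (deg T) (shift X) <= 0.
Proof.
move=> treeT.
pose C := \sum_(q in P) \sum_(n in N) weight [set parent T q n; n].
have lt_C z : feasible z -> objective (deg T) z <= C.
  exact: objective_le _ treeT z.
suff opt m z : feasible z -> C - objective (deg T) z < m%:Z ->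
    exists2 z, feasible z &
      forall X, closed_under z X -> objective (deg T) (shift X) <= 0.
  pose z0 (_ : V) : int := 0.
  have f0 : feasible z0.
    by move=> f _; rewrite /load big1 // exprn_ge0.
  apply: (opt `|C - objective (deg T) z0|.+1 z0 f0); lia.
elim: m z => [|m IHm] z fz lt_m; first by have := lt_C z fz; lia.
case: (pickP [pred X | closed_under z X && (0 < objective (deg T) (shift X))]).
  move=> X /andP[clX ltX]; apply: IHm (feasible_shift fz clX) _.
  by rewrite objectiveD; lia.
move=> noX; exists z => // X clX; have := noX X.
by rewrite /= clX /= => /negbT; rewrite -leNgt.
Qed.

(** * Every degree vector on P is that of a regular tree *)

(** Shifting on all nodes changes no load. *)
Lemma objective_shiftT T : T \in spanning_trees e ->
  objective (deg T) (shift setT) = 0.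
Proof.
move=> treeT; rewrite (objective_parent treeT).
rewrite big1 // => q qP; rewrite big1 // => n nN.
have epn := parent_edge treeT qP nN.
by rewrite (loadE _ epn) /shift !inE (side_edge epn) subrr.
Qed.

Lemma objective_shiftC f X :
  objective f (shift X) + objective f (shift (~: X)) = objective f (shift setT).
Proof.
rewrite -objectiveD /objective; congr (_ + _ * _); apply: eq_bigr => x _;
  by rewrite /shift !inE; case: (x \in X); rewrite ?addr0 ?add0r.
Qed.

Lemma sum_deg_P T : T \in spanning_trees e ->
  (\sum_(p in P) deg T p = #|N| + #|P| - 1)%N.
Proof.
move=> treeT; have [/set0Pn[q qP] _ _ _ _] := PN_bip.
rewrite (eq_bigr _ (fun p => deg_parent treeT qP)).
rewrite big_split /=; have -> : (\sum_(p in P) (p != q) = #|P| - 1)%N.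
  rewrite (bigD1 q) //= eqxx add0n (eq_bigr (fun=> 1%N)); last first.
    by move=> p /andP[_ ->].
  rewrite (cardD1 q) qP /= add1n subn1 /= sum1_card.
  by apply: eq_card => p; rewrite !inE andbC.
have Pgt0 : (0 < #|P|)%N by apply/card_gt0P; exists q.
rewrite addnBA //; congr (_ + _ - 1)%N.
rewrite -[RHS]sum1_card.
rewrite [RHS](partition_big (parent T q) (mem P)) /=; last first.
  by move=> n nN; apply: (parent_in treeT).
apply: eq_bigr => p _; rewrite -sum1_card; apply: eq_bigl => n.
by rewrite inE.
Qed.

Lemma regular_exists T : T \in spanning_trees e ->
  exists T', [/\ T' \in spanning_trees e, regular T' & {in P, deg T' =1 deg T}].
Proof.
move=> treeT; have [z fz optz] := local_optimum treeT.
have [Pn0 _ _ _ _] := PN_bip; have [p0 p0P] := set0Pn _ Pn0.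
set T' := tight z.
have T'e : T' \subset edges e by apply/subsetP => f; rewrite inE => /andP[].
have symT' := sym_connect_sym (adj_sym T').
have class_all p : p \in P -> forall x, connect (adj T') p x.
  move=> pP; set X := [set x | connect (adj T') p x].
  have X_adj x y : adj T' x y -> (x \in X) = (y \in X).
    by move=> xy; rewrite !inE; apply: (same_connect_r symT'); apply: connect1.
  have clX : closed_under z X.
    by apply/closed_underP => p1 n1 _ _ /X_adj ->.
  have clXC : closed_under z (~: X).
    by apply/closed_underP => p1 n1 _ _ /X_adj; rewrite !inE => ->.
  have XC := objective_shiftC (deg T) X; rewrite objective_shiftT // in XC.
  have X0 : objective (deg T) (shift X) = 0.
    by have := optz _ clX; have := optz _ clXC; lia.
  (* The supplies are 1 and the demands 0 modulo #|P|, so #|P| divides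
     #|P :&: X|, which is positive as p is in X. *)
  have PX : P \subset X.
    apply/setIidPl/eqP; rewrite eqEcard subsetIl /=.
    have PXgt0 : (0 < #|P :&: X|)%N.
      by apply/card_gt0P; exists p; rewrite !inE pP connect0.
    move: X0; rewrite objective_shift big_split /= -mulr_sumr sumr_const natz.
    set A := \sum_(i in _) _ => X0.
    have eqk : #|P :&: X|%:Z = #|P|%:Z * (#|N :&: X|%:Z - A).
      rewrite mulrBr; lia.
    have : 0 < #|N :&: X|%:Z - A by nia.
    nia.
  have NX : N \subset X.
    apply/setIidPl/eqP; rewrite eqEcard subsetIl /=.
    have := objective_shiftT treeT; have := X0; rewrite !objective_shift.
    rewrite (setIidPl PX) !setIT.
    have : (0 < #|P|)%N by apply/card_gt0P; exists p.
    nia.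
  move=> x; suff : x \in X by rewrite inE.
  have [xP | xP] := boolP (x \in P); first exact: (subsetP PX).
  by apply: (subsetP NX); rewrite in_N.
have treeT' : T' \in spanning_trees e.
  apply/spanning_treeP; split=> //; last exact: tight_acyclic.
  apply/forallP => x; apply/forallP => y.
  by apply: connect_trans (class_all p0 p0P y); rewrite symT'; apply: class_all.
exists T'; split=> //; first by exists z.
have deg_ge p : p \in P -> (deg T p <= deg T' p)%N.
  move=> pP; set A := [set y | adj T' p y].
  have AN : A \subset N.
    apply/subsetP => n; rewrite inE => /(adj_edge T'e)/edge_flip.
    by rewrite in_N pP => ->.
  (* The only node of P in this set is p, whose neighbours it contains. *)
  have clX : closed_under z (p |: A).
    apply/closed_underP => p1 n1 p1P n1N p1n1; rewrite !inE => /orP[/eqP eqp|].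
      by rewrite /adj -eqp p1n1 orbT.
    move=> pA; have : p1 \in N by apply: (subsetP AN); rewrite inE.
    by rewrite in_N p1P.
  have := optz _ clX; rewrite objective_shift.
  have -> : P :&: (p |: A) = [set p].
    apply/setP => x; rewrite !inE.
    have [-> | _] := eqVneq x p; first by rewrite pP.
    apply/negP => /andP[xP xA].
    have : x \in N by apply: (subsetP AN); rewrite inE.
    by rewrite in_N xP.
  have -> : N :&: (p |: A) = A.
    apply/setP => x; rewrite in_setI in_setU1; have [-> | _] := eqVneq x p.
      rewrite in_N pP /=; apply/esym/negP => /(subsetP AN).
      by rewrite in_N pP.
    by apply/andP/idP => [[] // | xA]; split=> //; apply: (subsetP AN).
  rewrite big_set1 (degE T'e) -/A.
  have : (0 < #|P|)%N by apply/card_gt0P; exists p.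
  nia.
have := sum_deg_P treeT'; rewrite -(sum_deg_P treeT) => /eqP eqsum.
have leqif_deg p : p \in P ->
    (deg T p <= deg T' p ?= iff (deg T p == deg T' p))%N.
  by move=> pP; split=> //; apply: deg_ge.
have [_] := leqif_sum leqif_deg; rewrite eq_sym eqsum => /esym/forall_inP eqdeg.
by move=> p pP; apply/esym/eqP/eqdeg.
Qed.

(** * Counting *)

(** Regularity quantifies over infinitely many potentials, so membership is
decided classically. *)
Definition regular_trees := [set T in spanning_trees e | `[< regular T >]].

Lemma card_deg_vectors :
  #|` [fset deg_vector T P | T in spanning_trees e]%fset| = #|regular_trees|.
Proof.
have -> : [fset deg_vector T P | T in spanning_trees e]%fset =
          [fset deg_vector T P | T in regular_trees]%fset.
  apply/fsetP => d; apply/imfsetP/imfsetP => -[T /= treeT ->]; last first.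
    by exists T => //=; case/setIdP: treeT.
  have [T' [treeT' regT' eqdeg]] := regular_exists treeT.
  exists T'; first by rewrite /= inE treeT'; apply/asboolP.
  by apply/ffunP => i; rewrite !ffunE eqdeg // (valP i).
rewrite card_in_imfset ?cardE //= => T1 T2.
move=> /setIdP[tree1 /asboolP reg1] /setIdP[tree2 /asboolP reg2] eqd.
apply: (regular_inj tree1 tree2 reg1 reg2) => p pP.
have := congr1 (fun d : {ffun {i | i \in P} -> nat} => d (Sub p pP)) eqd.
by rewrite !ffunE.
Qed.

End Bipartite.

Theorem lemma8 (V : finType) (e : rel V) (P N : {set V})
    (e_simple : simple_graph e) (PN_bip : bipartition e P N) :
  #|` [fset deg_vector T P | T in spanning_trees e]%fset| =
  #|` [fset deg_vector T N | T in spanning_trees e]%fset|.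
Proof.
rewrite (card_deg_vectors e_simple PN_bip).
suff NP_bip : bipartition e N P by rewrite (card_deg_vectors e_simple NP_bip).
have [Pn0 Nn0 dPN PuN bip] := PN_bip.
split=> //; first by rewrite disjoint_sym.
  by rewrite setUC.
by move=> x y /bip[[]|[]] ? ?; [right | left].
Qed.
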